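(* Suppose $\theta$ and $\lambda$ are regular cardinals and either $\theta^+<\lambda<\theta^{+\theta}$ or $\lambda$ is $\theta$-inaccessible. Let $\mathcal{D}$ be a locally downward coherent $\theta$-covering matrix for $\lambda$. Then $S^\lambda_{>\theta}\setminus A_{\mathcal{D}}$ is non-stationary in $\lambda$.
   Context: $\lambda$ is $\theta$-inaccessible if $\kappa^\theta<\lambda$ for all $\kappa<\lambda$; $S^\lambda_{>\theta}=\{\alpha<\lambda\mid\mathrm{cf}(\alpha)>\theta\}$. A $\theta$-covering matrix for $\lambda$ is $\mathcal{D}=\langle D(i,\beta)\mid i<\theta,\beta<\lambda\rangle$ with $\beta=\bigcup_{i<\theta}D(i,\beta)$, $D(i,\beta)\subseteq D(j,\beta)$ for $i<j$, and for $\beta<\gamma<\lambda$, $i<\theta$ some $j<\theta$ with $D(i,\beta)\subseteq D(j,\gamma)$. Locally downward coherent: for every $X\subseteq\lambda$ with $|X|\le\theta$ there is $\gamma_X<\lambda$ such that for all $\beta<\lambda$, $i<\theta$ there is $j<\theta$ with $X\cap D(i,\beta)\subseteq X\cap D(j,\gamma_X)$. $\beta\in S^\lambda_{>\theta}$ is a good point for $\mathcal{D}$ if there is an unbounded $A\subseteq\beta$ such that for every $\gamma<\beta$ there are $\alpha<\beta$, $i<\theta$ with $A\cap\gamma\subseteq D(i,\alpha)$; $A_{\mathcal{D}}$ is the set of good points. *)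

(* Defs.v *)
From HB Require Import structures.
From mathcomp Require Import all_boot all_order.
From mathcomp Require Import all_classical.

Set Implicit Arguments.
Unset Strict Implicit.
Unset Printing Implicit Defensive.

Local Open Scope classical_set_scope.
Local Open Scope card_scope.

Record wellorder := WellOrder {
  wo_car :> Type;
  wo_lt : wo_car -> wo_car -> Prop;
  wo_trans : forall x y z, wo_lt x y -> wo_lt y z -> wo_lt x z;
  wo_total : forall x y, [\/ wo_lt x y, x = y | wo_lt y x];
  wo_wf : well_founded wo_lt }.

HB.instance Definition _ := gen_eqMixin wellorder.
HB.instance Definition _ := gen_choiceMixin wellorder.

Definition wo_iso (v w : wellorder) : Prop :=
  exists2 f : v -> w, bijective f & forall x y, wo_lt x y <-> wo_lt (f x) (f y).

Fact sval_inj T (P : T -> Prop) (a b : {x | P x}) : sval a = sval b -> a = b.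
Proof. by case: a b => [x Px] [y Py] /= xy; case: y / xy Py => Py; rewrite (Prop_irrelevance Px Py). Qed.

Section InitialSegment.
Variables (w : wellorder) (x : w).
Let car := {y : w | wo_lt y x}.
Let lt (a b : car) := wo_lt (sval a) (sval b).

Fact wo_seg_trans a b c : lt a b -> lt b c -> lt a c.
Proof. exact: wo_trans. Qed.

Fact wo_seg_total a b : [\/ lt a b, a = b | lt b a].
Proof.
case: (wo_total (sval a) (sval b)) => [h|h|h]; [by constructor 1| |by constructor 3].
by constructor 2; apply: sval_inj.
Qed.

Fact wo_seg_wf : well_founded lt.
Proof.
move=> a; move: {-1}(sval a) (erefl (sval a)) => y.
elim/(well_founded_ind (@wo_wf w)): y a => y IH a ay.
by split=> b ba; apply: (IH (sval b)) => //; rewrite -ay.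
Qed.

Definition wo_seg : wellorder := WellOrder wo_seg_trans wo_seg_total wo_seg_wf.
End InitialSegment.

Definition wo_isob (v w : wellorder) : bool := `[< wo_iso v w >].

Fact wo_iso_refl w : wo_iso w w.
Proof. by exists id => //; exists id. Qed.

Fact wo_iso_sym v w : wo_iso v w -> wo_iso w v.
Proof.
move=> [f [g fg gf] fP]; exists g; first by exists f.
by move=> x y; rewrite -{1}(gf x) -{1}(gf y); split => /fP.
Qed.

Fact wo_iso_trans u v w : wo_iso u v -> wo_iso v w -> wo_iso u w.
Proof.
move=> [f bf fP] [g bg gP]; exists (g \o f); first exact: bij_comp.
by move=> x y; split => [/fP/gP|/gP/fP].
Qed.

Fact wo_isob_refl : reflexive wo_isob.
Proof. by move=> w; apply/asboolP/wo_iso_refl. Qed.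

Fact wo_isob_sym : symmetric wo_isob.
Proof. by move=> v w; apply/asboolP/asboolP; apply: wo_iso_sym. Qed.

Fact wo_isob_trans : transitive wo_isob.
Proof.
by move=> v u w /asboolP uv /asboolP vw; apply/asboolP/(wo_iso_trans uv vw).
Qed.

Canonical wo_isob_equiv := EquivRel wo_isob wo_isob_refl wo_isob_sym wo_isob_trans.

(* The ordinals, as isomorphism classes of well-orders on the types of a fixed
   universe. *)
Definition On := {eq_quot wo_isob}%qT.
HB.instance Definition _ := Choice.on On.
HB.instance Definition _ := EqQuotient.on On.

Definition otype (w : wellorder) : On := (\pi_On w)%qT.

Definition On_lt (a b : On) : bool :=
  `[< exists x : repr b, a = otype (wo_seg x) >].

Lemma otype_eq v w : (otype v = otype w) <-> wo_iso v w.
Proof.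
split=> [/eqmodP/asboolP//|vw]; exact/eqmodP/asboolP.
Qed.

Lemma otype_repr a : otype (repr a) = a.
Proof. exact: reprK. Qed.

Fact wo_seg_iso (v w : wellorder) (f : v -> w) (x : v) : bijective f ->
  (forall y z, wo_lt y z <-> wo_lt (f y) (f z)) -> wo_iso (wo_seg x) (wo_seg (f x)).
Proof.
move=> [g fg gf] fP.
have gP y : wo_lt y (f x) -> wo_lt (g y) x by move=> h; apply/fP; rewrite gf.
exists (fun y : wo_seg x => exist _ (f (sval y)) ((fP _ _).1 (svalP y)) : wo_seg (f x)).
  exists (fun y : wo_seg (f x) => exist _ (g (sval y)) (gP _ (svalP y)) : wo_seg x).
    by case=> y yx; apply: sval_inj => /=.
  by case=> y yx; apply: sval_inj => /=.
by move=> y z; apply: fP.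
Qed.

Lemma On_ltP a w : On_lt a (otype w) <-> exists x : w, a = otype (wo_seg x).
Proof.
have /otype_eq rw : otype (repr (otype w)) = otype w by rewrite otype_repr.
split=> [/asboolP[x ->]|[x ->]].
  have [f bf fP] := rw; exists (f x); apply/otype_eq; exact: wo_seg_iso.
have [f bf fP] := wo_iso_sym rw; apply/asboolP; exists (f x).
by apply/otype_eq; exact: wo_seg_iso.
Qed.

Fact wo_seg_seg (w : wellorder) (x : w) (y : wo_seg x) :
  otype (wo_seg y) = otype (wo_seg (sval y)).
Proof.
apply/otype_eq; case: y => y yx /=.
exists (fun z : wo_seg (exist _ y yx : wo_seg x) =>
  exist _ (sval (sval z)) (svalP z) : wo_seg y); last by [].
exists (fun z : wo_seg y =>
  exist _ (exist _ (sval z) (wo_trans (svalP z) yx) : wo_seg x) (svalP z) :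
  wo_seg (exist _ y yx : wo_seg x)).
  by case=> [[z zx] zy]; do 2!apply: sval_inj => /=.
by case=> z zy; apply: sval_inj.
Qed.

Lemma otype_seg_lt (w : wellorder) (x y : w) :
  wo_lt x y -> On_lt (otype (wo_seg x)) (otype (wo_seg y)).
Proof.
by move=> xy; apply/On_ltP; exists (exist _ x xy); rewrite wo_seg_seg.
Qed.

Lemma On_lt_wf : well_founded On_lt.
Proof.
have acc_seg (w : wellorder) (x : w) : Acc On_lt (otype (wo_seg x)).
  elim/(well_founded_ind (@wo_wf w)): x => x IH.
  by split=> b /On_ltP[y ->]; rewrite wo_seg_seg; apply: IH; case: y.
by move=> a; split=> b /asboolP[x ->].
Qed.

Lemma On_lt_irr : irreflexive On_lt.
Proof.
move=> a; apply/negbTE/negP.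
by elim/(well_founded_ind On_lt_wf): a => a IH aa; apply: (IH a).
Qed.

Lemma On_lt_trans : transitive On_lt.
Proof.
move=> b a c ab; rewrite -(otype_repr c); move: (repr c) => w /On_ltP[x bE].
move: ab; rewrite bE => /On_ltP[y ->]; rewrite wo_seg_seg.
by apply/On_ltP; exists (sval y).
Qed.

Lemma otype_seg_inj (w : wellorder) (x y : w) :
  otype (wo_seg x) = otype (wo_seg y) -> x = y.
Proof.
move=> E; case: (wo_total x y) => // /otype_seg_lt; by rewrite E On_lt_irr.
Qed.

Lemma otype_segE (w : wellorder) (x y : w) :
  wo_lt x y <-> On_lt (otype (wo_seg x)) (otype (wo_seg y)).
Proof.
split=> [|xy]; first exact: otype_seg_lt.
case: (wo_total x y) => // [E|/otype_seg_lt yx]; first by rewrite E On_lt_irr in xy.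
by have := On_lt_trans xy yx; rewrite On_lt_irr.
Qed.

Lemma On_ext a b : (forall c, On_lt c a <-> On_lt c b) -> a = b.
Proof.
rewrite -(otype_repr a) -(otype_repr b).
move: (repr a) (repr b) => v w H; apply/otype_eq.
have Hf (x : v) : exists y : w, otype (wo_seg x) = otype (wo_seg y).
  by apply/On_ltP/H/On_ltP; exists x.
have Hg (y : w) : exists x : v, otype (wo_seg y) = otype (wo_seg x).
  by apply/On_ltP/H/On_ltP; exists y.
have [f fP] := choice Hf; have [g gP] := choice Hg.
exists f.
  by exists g => [x|y]; apply: otype_seg_inj; [rewrite -gP -fP|rewrite -fP -gP].
by move=> x y; rewrite !otype_segE !fP.
Qed.

Lemma On_lt_total a b : a != b -> On_lt a b || On_lt b a.
Proof.
move=> ab; suff: [\/ On_lt a b, a = b | On_lt b a].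
  by case=> [->|/eqP|->]; rewrite ?orbT // (negbTE ab).
elim/(well_founded_ind On_lt_wf): a b {ab} => a IHa b.
elim/(well_founded_ind On_lt_wf): b => b IHb.
have [?|ab] := boolP (On_lt a b); first by constructor 1.
have [?|ba] := boolP (On_lt b a); first by constructor 3.
constructor 2; apply: On_ext => c; split=> [ca|cb].
  case: (IHa c ca b) => // [cb|bc]; first by rewrite -cb ca in ba.
  by rewrite (On_lt_trans bc ca) in ba.
case: (IHb c cb) => // [ac|ac]; last by rewrite ac cb in ab.
by rewrite (On_lt_trans ac cb) in ab.
Qed.

Fact On_display : Order.disp_t. Proof. exact: Order.Disp tt tt. Qed.

HB.instance Definition _ := @Order.LtOrder.Build On_display On
  (fun a b => (a == b) || On_lt a b) On_lt _ _
  (fun _ _ => erefl) (fun _ _ => erefl) (fun _ _ => erefl)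
  On_lt_irr On_lt_trans On_lt_total.

Fact void_wo_trans (x y z : void) : False -> False -> False. Proof. by []. Qed.
Fact void_wo_total (x y : void) : [\/ False, x = y | False]. Proof. by case: x. Qed.
Fact void_wo_wf : well_founded (fun x y : void => False). Proof. by case. Qed.

Definition On0 : On := otype (WellOrder void_wo_trans void_wo_total void_wo_wf).

Local Open Scope order_scope.

(* [below a] is the ordinal [a] viewed, in von Neumann's way, as the set of the
   smaller ordinals. *)
Definition below (a : On) : set On := [set x | x < a].

(* The value On0 on the empty set is never used below: succ_card, plus_card and
   cf take the least element of a nonempty set. *)
Definition least (P : set On) : On := xget On0 (P `&` lbound P).

Definition cardinal (k : On) : Prop := forall a, a < k -> below a #!= below k.

Definition succ_card (k : On) : On := least [set m | cardinal m /\ k < m].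

(* [plus_card k xi] is k^{+xi}: the least cardinal which is at least [k] and
   above every k^{+eta} with [eta < xi]; this merges the zero, successor and
   limit clauses of the recursion. *)
Definition plus_card (k : On) : On -> On :=
  Fix On_lt_wf (fun _ => On) (fun xi rec =>
    least [set m | [/\ cardinal m, k <= m &
                       forall eta (h : On_lt eta xi), rec eta h < m]]).

(* [<=] rather than [<], so that successor ordinals get cofinality 1. *)
Definition unbounded_in (b : On) (A : set On) : Prop :=
  A `<=` below b /\ forall g, g < b -> exists2 a, A a & g <= a.

Definition cf (b : On) : On :=
  least [set g | exists2 A, unbounded_in b A & A #= below g].

Definition regular_cardinal (k : On) : Prop :=
  [/\ cardinal k, infinite_set (below k) & cf k = k].

(* [below t -> below k] is the type of functions from t to k, so that its
   cardinality is k^t. *)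
Definition inaccessible_for (t l : On) : Prop :=
  forall k, cardinal k -> k < l ->
    let k_pow_t := [set: below t -> below k] in
    (k_pow_t #<= below l) /\ ~ (below l #<= k_pow_t).

Definition limit_of (C : set On) (d : On) : Prop :=
  On0 < d /\ forall g, g < d -> exists2 a, C a & g < a < d.

Definition club (l : On) (C : set On) : Prop :=
  unbounded_in l C /\ forall d, d < l -> limit_of C d -> C d.

Definition stationary (l : On) (S : set On) : Prop :=
  forall C, club l C -> S `&` C !=set0.

(* Only the values D i b with i < t and b < l are meaningful. *)
Definition covering_matrix (t l : On) (D : On -> On -> set On) : Prop :=
  [/\ forall b, b < l -> below b = \bigcup_(i in below t) D i b,
      forall b i j, b < l -> i < j -> j < t -> D i b `<=` D j b &
      forall b g i, b < g -> g < l -> i < t ->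
        exists2 j, j < t & D i b `<=` D j g].

Definition locally_downward_coherent (t l : On) (D : On -> On -> set On) : Prop :=
  forall X : set On, X `<=` below l -> X #<= below t ->
    exists2 gX, gX < l &
      forall b i, b < l -> i < t ->
        exists2 j, j < t & X `&` D i b `<=` X `&` D j gX.

Definition S_gt (l t : On) : set On := [set a | a < l /\ t < cf a].

Definition good_points (t l : On) (D : On -> On -> set On) : set On :=
  [set b | S_gt l t b /\
    exists2 A, unbounded_in b A &
      forall g, g < b -> exists a i, [/\ a < b, i < t & A `&` below g `<=` D i a]].

(* Main.v *)
(** Both hypotheses on [lambda] give the same strengthening of local downward
    coherence: every [c < lambda] has some [g < lambda] such that each trace
    [c ∩ D(i, b)] is contained in some [D(j, g)].

    If [lambda] is [theta]-inaccessible, let [g] bound the [gamma_X] of all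
    [X ⊆ c] of size at most [theta]: a trace contained in no [D(j, g)] would have
    a subset of size at most [theta] contained in no [D(j, g)].  If
    [lambda < theta^{+theta}], argue by induction on the cardinality of the set
    whose traces are considered; a cardinal between [theta] and [lambda] never
    has cofinality [theta], so writing the set as an increasing union of smaller
    sets, the indices [j] obtained for the pieces are either bounded in [theta]
    or constant on a cofinal set of pieces.

    Now let [b] be closed under [c |-> g] with [cf b > theta].  Some [D(i, b)] is
    unbounded in [b], and its traces on the [c < b] show that [b] is good. *)

Require Import Defs.
From HB Require Import structures.
From mathcomp Require Import all_boot all_order all_classical.

Local Open Scope classical_set_scope.
Local Open Scope order_scope.

Import Order.TTheory.

Set Implicit Arguments.
Unset Strict Implicit.
Unset Printing Implicit Defensive.

Local Open Scope card_scope.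

HB.instance Definition _ := isPointed.Build On On0.

(** * Cardinality of sets of ordinals, and least elements *)

Lemma inj_le_card T U (A : set T) (B : set U) (f : T -> U) :
  set_fun A B f -> set_inj A f -> A #<= B.
Proof.
by move=> fAB fI; have /injfunPex[g] := ex_intro2 _ _ f fAB fI; exact: inj_card_le.
Qed.

Lemma card_le_inj T (A : set T) (B : set On) : A #<= B ->
  exists2 f : T -> On, set_fun A B f & set_inj A f.
Proof. by move=> /pcard_leP/injfunPex. Qed.

Lemma On_ind (P : On -> Prop) :
  (forall a, (forall b, b < a -> P b) -> P a) -> forall a, P a.
Proof. exact: (well_founded_ind On_lt_wf). Qed.

Lemma leastP (P : set On) : P !=set0 -> P (least P) /\ lbound P (least P).
Proof.
move=> [x Px]; apply: (@xgetPex _ _ (P `&` lbound P)).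
apply: contrapT => nP; move: x Px; elim/On_ind => a IH Pa; apply: nP.
by exists a; split=> // y Py; rewrite leNgt; apply/negP => /IH; exact.
Qed.

Lemma least_in (P : set On) a : P a -> P (least P).
Proof. by move=> Pa; have [] := @leastP P (ex_intro _ a Pa). Qed.

Lemma least_le (P : set On) a : P a -> least P <= a.
Proof. by move=> Pa; have [_ /(_ a Pa)] := @leastP P (ex_intro _ a Pa). Qed.

Lemma lt_least (P : set On) a : a < least P -> ~ P a.
Proof. by move=> + /least_le; rewrite ltNge => /negP. Qed.

Lemma le_below a b : a <= b -> below a `<=` below b.
Proof. by move=> ab x /= xa; apply: lt_le_trans ab. Qed.

Lemma card_below_otype (w : wellorder) : below (otype w) #= [set: w].
Proof.
suff -> : below (otype w) = (fun y : w => otype (wo_seg y)) @` setT.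
  by apply: inj_card_eq => x y _ _; exact: otype_seg_inj.
apply/seteqP; split=> [x /On_ltP[y ->]|_ [y _ <-]]; first by exists y.
by apply/On_ltP; exists y.
Qed.

Section SubWellorder.
Variables (w : wellorder) (P : w -> Prop).
Let car := {y : w | P y}.
Let lt (a b : car) := wo_lt (sval a) (sval b).

Fact wo_sub_trans a b c : lt a b -> lt b c -> lt a c.
Proof. exact: wo_trans. Qed.

Fact wo_sub_total a b : [\/ lt a b, a = b | lt b a].
Proof.
case: (wo_total (sval a) (sval b)) => [h|h|h]; [by constructor 1| |by constructor 3].
by constructor 2; apply: sval_inj.
Qed.

Fact wo_sub_wf : well_founded lt.
Proof.
move=> a; move: {-1}(sval a) (erefl (sval a)) => y.
elim/(well_founded_ind (@wo_wf w)): y a => y IH a ay.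
by split=> b ba; apply: (IH (sval b)) => //; rewrite -ay.
Qed.

Definition wo_sub : wellorder := WellOrder wo_sub_trans wo_sub_total wo_sub_wf.
End SubWellorder.

(** [g] is the order type of [S]. The induced order is put on the matching subset of the carrier of
    [repr b], as the ordinals themselves live in a larger universe. *)
Lemma card_eq_below b (S : set On) : S `<=` below b -> exists g, S #= below g.
Proof.
move=> Sb; pose v := wo_sub (fun y : repr b => S (otype (wo_seg y))).
exists (otype v); apply: card_eq_trans (card_esym (card_below_otype v)).
pose f (y : v) := otype (wo_seg (sval y)).
suff -> : S = f @` setT by apply: inj_card_eq => x y _ _ /otype_seg_inj/sval_inj.
apply/seteqP; split=> [x Sx|_ [[y Sy] _ <-]//].
have : x < otype (repr b) by rewrite otype_repr; exact: Sb.
by move=> /On_ltP[y xy]; rewrite xy in Sx *; exists (exist _ y Sx).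
Qed.

Lemma cardinal_ncard_le k a : cardinal k -> a < k -> ~ (below k #<= below a).
Proof.
move=> kC ak ka; have /negP := kC _ ak; apply; apply/card_eqPle; split=> //.
exact/subset_card_le/le_below/ltW.
Qed.

Lemma card_of_below a :
  exists k, [/\ cardinal k, k <= a & below k #= below a].
Proof.
pose P := [set k | below k #= below a].
have Pa : P a by apply: card_eqxx.
exists (least P); split; [|exact: least_le|exact: (least_in Pa)].
move=> b /lt_least Pb; apply/negP => bP; apply: Pb.
exact: card_eq_trans bP (least_in Pa).
Qed.

(** * Cofinality and bounded sets *)

Lemma cf_le b : cf b <= b.
Proof.
apply: least_le; exists (below b); last exact: card_eqxx.
by split=> // g gb; exists g.
Qed.

Lemma unbounded_card b (A : set On) : unbounded_in b A -> below (cf b) #<= A.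
Proof.
move=> Aub; have [g Ag] := card_eq_below Aub.1; rewrite (card_le_eqr Ag).
by apply/subset_card_le/le_below/least_le; exists A.
Qed.

Lemma bounded_or_unbounded b (A : set On) : A `<=` below b ->
  (exists2 g, g < b & A `<=` below g) \/ unbounded_in b A.
Proof.
move=> Ab; have [|nA] := pselect (exists2 g, g < b & A `<=` below g); first by left.
right; split=> // g gb; apply: contrapT => nAg; apply: nA; exists g => // a Aa.
by rewrite /below /= ltNge; apply/negP => ga; apply: nAg; exists a.
Qed.

Lemma cf_gt_bounded b t (A : set On) : t < cf b -> A #<= below t ->
  A `<=` below b -> exists2 g, g < b & A `<=` below g.
Proof.
move=> tb At /bounded_or_unbounded[//|Aub]; exfalso.
move: (tb); rewrite ltNge => /negP; apply; apply: least_le; exists A => //.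
apply/card_eqPle; split=> //; apply: card_le_trans (unbounded_card Aub).
exact/subset_card_le/le_below/ltW.
Qed.

Lemma regular_bounded k (A : set On) : regular_cardinal k ->
  ~ (below k #<= A) -> A `<=` below k -> exists2 g, g < k & A `<=` below g.
Proof.
by move=> [_ _ kcf] nA /bounded_or_unbounded[//|/unbounded_card]; rewrite kcf.
Qed.

Lemma regular_image_bounded k a (f : On -> On) : regular_cardinal k -> a < k ->
  (forall x, x < a -> f x < k) ->
  exists2 g, g < k & forall x, x < a -> f x < g.
Proof.
move=> kR ak fk; have [|_ [x xa <-]|g gk fg] := @regular_bounded k (f @` below a) kR.
- move=> kf; have := card_le_trans kf (card_image_le _ _).
  by apply: cardinal_ncard_le => //; case: kR.
- exact: fk.
- by exists g => // x xa; apply: fg; exists x.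
Qed.

(** * The Goedel well-order and squares of infinite sets of ordinals *)

Definition godel_lt (p q : On * On) : Prop :=
  let m := Order.max p.1 p.2 in let n := Order.max q.1 q.2 in
  m < n \/ m = n /\ (p.1 < q.1 \/ p.1 = q.1 /\ p.2 < q.2).

Lemma godel_lt_wf : well_founded godel_lt.
Proof.
suff W m : forall x y, Order.max x y = m -> Acc godel_lt (x, y).
  by case=> x y; apply: W.
elim/On_ind: m => m IHm; elim/On_ind => x IHx; elim/On_ind => y IHy xym.
split=> -[x' y']; rewrite /godel_lt /= xym => -[lt_m|[E [lt_x|[xx' lt_y]]]].
- exact: IHm lt_m _ _ erefl.
- exact: IHx lt_x _ E.
- by rewrite xx' in E *; exact: IHy lt_y E.
Qed.

Lemma godel_lt_total p q : [\/ godel_lt p q, p = q | godel_lt q p].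
Proof.
case: p q => x y [x' y']; rewrite /godel_lt /=.
have [lt_m|lt_m|<-] := ltgtP (Order.max x y) (Order.max x' y').
- by constructor 1; left.
- by constructor 3; left.
have [lt_x|lt_x|<-] := ltgtP x x'.
- by constructor 1; right; split=> //; left.
- by constructor 3; right; split=> //; left.
have [lt_y|lt_y|<-] := ltgtP y y'.
- by constructor 1; right; split=> //; right.
- by constructor 3; right; split=> //; right.
- by constructor 2.
Qed.

(** The order type of the predecessors of [p], computed as the least value not taken on them. *)
Definition godel_rank : On * On -> On :=
  Fix godel_lt_wf (fun _ => On)
    (fun p rec => least [set o | forall q (h : godel_lt q p), rec q h <> o]).

Lemma godel_rankE p :
  godel_rank p = least [set o | forall q, godel_lt q p -> godel_rank q <> o].
Proof.
rewrite {1}/godel_rank Fix_eq // => {}p f g fg; congr (least _).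
by apply/funext => o; apply/propext; split=> H q h; [rewrite -fg|rewrite fg]; apply: H.
Qed.

(** Hilbert's hotel along an injected sequence [e]: [m] goes to [e 0], each [e n] to [e n.+1], and
    all other points stay fixed. *)
Lemma infinite_card_below1 m : infinite_set (below m) ->
  below m `|` [set m] #<= below m.
Proof.
move=> /infiniteP/card_le_inj[e em eI].
have {}em n : e n < m by apply: em.
have {}eI n n' : e n = e n' -> n = n' by apply: eI; rewrite inE.
pose R x y := [\/ x = m /\ y = e 0%N, exists2 n, x = e n & y = e n.+1 |
  [/\ x < m, forall n, x <> e n & y = x]].
have Rex x : exists y, (below m `|` [set m]) x -> R x y.
  have [->|xm] := eqVneq x m; first by exists (e 0%N) => _; constructor 1.
  have [[n xn]|nx] := pselect (exists n, x = e n).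
    by exists (e n.+1) => _; constructor 2; exists n.
  exists x => -[?|/eqP]; last by rewrite (negbTE xm).
  by constructor 3; split=> // n xn; apply: nx; exists n.
have [f fR] := choice Rex.
apply: (@inj_le_card _ _ _ _ f).
  by move=> x /fR[[_ ->]|[n _ ->]|[? _ ->]] //; apply: em.
move=> x y; rewrite !inE => /fR Rx /fR Ry fxy; move: Rx Ry; rewrite -fxy.
case=> [[-> ->]|[n -> ->]|[xm nx ->]]; case=> [[-> //]|[n' ->]|[ym ny]].
- by move=> /eI.
- by move=> yE; case: (ny 0%N).
- by move=> /eI.
- by move=> /eI[->].
- by move=> yE; case: (ny n.+1).
- by move=> xE; case: (nx 0%N).
- by move=> xE; case: (nx n'.+1).
- by [].
Qed.

(** If [a] were the largest element below [k], adding it to [below a] would not change the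
    cardinality, although [k] is a cardinal above [a]. *)
Lemma infinite_cardinal_succ k a : cardinal k -> infinite_set (below k) ->
  a < k -> exists2 b, b < k & a < b.
Proof.
move=> kC kinf ak; apply: contrapT => nb.
have kE : below k = below a `|` [set a].
  apply/seteqP; split=> [x xk|x [xa|->//]]; last exact: lt_trans xa ak.
  have [xa|ax|->] := ltgtP x a; [by left| |by right].
  by case: nb; exists x.
apply: (cardinal_ncard_le kC ak); rewrite kE; apply: infinite_card_below1 => afin.
by apply: kinf; rewrite kE finite_setU; split=> //; exact: finite_set1.
Qed.

Lemma card_le_setX T T' (A : set T) (A' : set T') (B B' : set On) :
  A #<= B -> A' #<= B' -> A `*` A' #<= B `*` B'.
Proof.
move=> /card_le_inj[f fB fI] /card_le_inj[g gB gI].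
apply: (@inj_le_card _ _ _ _ (fun p => (f p.1, g p.2))).
  by move=> [x y] [/= Ax Ay]; split; [apply: fB|apply: gB].
move=> [x y] [x' y']; rewrite !inE /= => -[xA yA] [xA' yA'] [fxx' gyy'].
by congr pair; [apply: fI|apply: gI] => //; rewrite inE.
Qed.

(* Minimal counterexample: for an infinite cardinal [a], initial segments of the
   Goedel well-order of [a * a] have cardinality below [a], so that its rank
   function injects [a * a] into [a]. *)
Lemma infinite_card_setX a : infinite_set (below a) ->
  below a `*` below a #<= below a.
Proof.
elim/On_ind: a => a IH ainf.
have cardX b : below b #= below a -> below b `*` below b #<= below b ->
    below a `*` below a #<= below a.
  move=> ba bb; rewrite -(card_le_eqr ba); apply: card_le_trans bb.
  by have /card_eqPle[_ ab] := ba; apply: card_le_setX.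
have [k [kC ka kcard]] := card_of_below a.
move: ka; rewrite le_eqVlt => /orP[/eqP ka|ka]; last first.
  apply: (cardX _ kcard (IH _ ka _)) => kfin; apply: ainf.
  by apply: card_le_finite kfin; case/card_eqPle: kcard.
rewrite {}ka in kC; move: kcard cardX => _ _.
(* As maxima are compared first, all predecessors of [p] lie in [M * M], which is finite or of size
   at most [m < a]. *)
have small p : p.1 < a -> p.2 < a -> ~ (below a #<= [set q | godel_lt q p]).
  move=> p1 p2; pose m := Order.max p.1 p.2; pose M := below m `|` [set m].
  have ma : m < a by rewrite /m gt_max p1.
  move=> aG; have aM : below a #<= M `*` M.
    apply: card_le_trans aG _; apply: subset_card_le => -[x y] /= xyp.
    have : Order.max x y <= m.
      by case: xyp => /= [/ltW//|[-> _]].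
    have inM z : z <= m -> M z.
      by rewrite le_eqVlt => /orP[/eqP->|]; [right|left].
    by rewrite ge_max => /andP[xm ym]; split; apply: inM.
  have [mfin|minf] := pselect (finite_set (below m)).
    apply: ainf; apply: card_le_finite aM _.
    by apply: finite_setX; rewrite finite_setU; split=> //; exact: finite_set1.
  apply: (cardinal_ncard_le kC ma); apply: card_le_trans aM _.
  apply: card_le_trans (IH _ ma minf).
  by apply: card_le_setX; exact: infinite_card_below1.
(* Otherwise every [o < a] is the rank of a predecessor of [p], against [small]. *)
have fresh p : p.1 < a -> p.2 < a ->
    exists2 o, o < a & forall q, godel_lt q p -> godel_rank q <> o.
  move=> p1 p2; apply: contrapT => nf; apply: (small p) => //.
  apply: (card_le_trans _ (card_image_le godel_rank _)).
  apply: subset_card_le => o oa; apply: contrapT => no; apply: nf.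
  by exists o => // q qp qo; apply: no; exists q.
apply: (@inj_le_card _ _ _ _ godel_rank) => [p [p1 p2]|p q].
  have [o oa Ho] := fresh p p1 p2; rewrite /below /= godel_rankE.
  exact: le_lt_trans (least_le Ho) oa.
have ne p' q' : p'.1 < a -> p'.2 < a -> godel_lt q' p' -> godel_rank q' <> godel_rank p'.
  move=> p1 p2; have [o _ Ho] := fresh p' p1 p2; rewrite (godel_rankE p').
  exact: (@least_in [set o | forall q, godel_lt q p' -> godel_rank q <> o] o Ho).
rewrite !inE => -[p1 p2] [q1 q2] pq; have [/ne|//|/ne] := godel_lt_total p q.
  by move=> /(_ q1 q2).
by move=> /(_ p1 p2); rewrite pq.
Qed.

(** * Cardinals between [t] and [t^{+t}] *)

Lemma plus_cardE k xi : plus_card k xi =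
  least [set m | [/\ cardinal m, k <= m & forall eta, eta < xi -> plus_card k eta < m]].
Proof.
rewrite {1}/plus_card Fix_eq // => {}xi f g fg; congr (least _).
apply/funext => o; apply/propext; split=> -[oC ko H]; split=> // eta h.
  by rewrite -fg; apply: H.
by rewrite fg; apply: H.
Qed.

(* The two alternatives are the limit and the successor case of [c = t^{+xi}];
   they replace the assertion that [cf c] differs from [t]. *)
Lemma cardinal_lt_plus_card t c : cardinal c -> t < c -> c < plus_card t t ->
  (exists2 xi, xi < t & exists s : On -> On,
     (forall eta, eta < xi -> s eta < c) /\
     (forall g, g < c -> exists2 eta, eta < xi & g < s eta)) \/
  (exists g, [/\ t <= g, g < c & forall a, a < c -> below a #<= below g]).
Proof.
(* [least P] is the index [xi] with [c = t^{+xi}]. *)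
move=> cC tc ct; pose P := [set x | c <= plus_card t x].
have Pt : P t by apply: ltW.
have xit : least P <= t by apply: least_le.
have below_xi eta : eta < least P -> plus_card t eta < c.
  by move=> /lt_least nP; rewrite ltNge; apply/negP.
have xiE : plus_card t (least P) = c.
  apply/eqP; rewrite eq_le; apply/andP; split; last exact: (least_in Pt).
  by rewrite plus_cardE; apply: least_le; split=> //; exact: ltW.
have [[g gc Hg]|ng] :=
    pselect (exists2 g, g < c & forall eta, eta < least P -> plus_card t eta <= g).
  (* A cardinal above [max g t] exceeds every [t^{+eta}] with [eta < xi], so it is at least [c]. *)
  right; exists (Order.max g t); split; [by rewrite le_max lexx orbT|by rewrite gt_max gc|].
  move=> a ac; have [k [kC ka kcard]] := card_of_below a.
  rewrite -(card_le_eql kcard); apply/subset_card_le/le_below.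
  rewrite leNgt; apply/negP; rewrite gt_max => /andP[gk tk].
  have : c <= k.
    rewrite -xiE plus_cardE; apply: least_le; split; [by []|exact: ltW|].
    by move=> eta /Hg etag; exact: le_lt_trans gk.
  by rewrite leNgt (le_lt_trans ka ac).
left; exists (least P).
  rewrite lt_neqAle xit andbT; apply/eqP => xiEt.
  by rewrite -{2}xiEt xiE ltxx in ct.
exists (plus_card t); split=> // g gc; apply: contrapT => nx; apply: ng.
by exists g => // eta etaxi; rewrite leNgt; apply/negP => ?; apply: nx; exists eta.
Qed.

(* [X] may be larger than [theta], unlike in [locally_downward_coherent]. *)
Definition captured (t l : On) (D : On -> On -> set On) (X : set On) (g : On) : Prop :=
  forall b i, b < l -> i < t -> exists2 j, j < t & X `&` D i b `<=` D j g.

(** * Capturing the traces on every [c < l] *)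

Section Captured.
Variables (t l : On) (D : On -> On -> set On).
Hypotheses (tR : regular_cardinal t) (lR : regular_cardinal l).
Hypotheses (cmD : covering_matrix t l D) (ldcD : locally_downward_coherent t l D).

Lemma captured_le X g h : g < h -> h < l -> captured t l D X g -> captured t l D X h.
Proof.
move=> gh hl Xg b i bl it; have [j jt XD] := Xg b i bl it.
have [_ _ /(_ g h j gh hl jt)[j' j't Djj']] := cmD.
by exists j' => // x /XD/Djj'.
Qed.

Lemma ldc_captured X : X `<=` below l -> X #<= below t ->
  exists2 g, g < l & captured t l D X g.
Proof.
move=> Xl Xt; have [g gl H] := ldcD Xl Xt; exists g => // b i bl it.
by have [j jt XD] := H b i bl it; exists j => // x /XD[].
Qed.

Lemma inaccessible_captured c : inaccessible_for t l -> c < l ->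
  exists2 g, g < l & captured t l D (below c) g.
Proof.
move=> inacc cl; have [k [kC kc kcard]] := card_of_below c.
have [_ nlk] := inacc k kC (le_lt_trans kc cl).
have /card_bijP[e [e' ee' e'e]] := kcard.
(* Coded by functions from [t] to [k], these subsets of [c] number fewer than [l], so one [g] bounds
   all the [G h]. *)
pose X (h : below t -> below k) : set On := range (fun j => set_val (e (h j))).
have Xc h x : X h x -> x < c by move=> [j _ <-]; exact: (set_valP (e (h j))).
have XG h : exists g, g < l /\ captured t l D (X h) g.
  have [||g] := @ldc_captured (X h); [| |by exists g].
    by move=> x /Xc xc; apply: lt_trans cl.
  apply: card_le_trans (card_image_le _ _) _.
  by case/card_eqPle: (card_setT (below t)).
have [G GP] := choice XG.
have [|_ [h _ <-]|g gl Gg] := @regular_bounded l (range G) lR.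
- by move=> lG; apply: nlk; exact: card_le_trans lG (card_image_le _ _).
- by case: (GP h).
exists g => // b i bl it; apply: contrapT => nj.
(* Diagonal choice: [x j] is a point of the trace outside [D j g], and the range of [x] is [X h] for
   [h = e' \o x]. *)
have bad (j : below t) : exists x : below c,
    D i b (set_val x) /\ ~ D (set_val j) g (set_val x).
  apply: contrapT => nx; apply: nj; exists (set_val j); first exact: (set_valP j).
  move=> x [xc xD]; apply: contrapT => nxD; apply: nx.
  by exists (SigSub (mem_set xc)).
have [x xP] := choice bad.
have [||j jt XD] := @captured_le (X (e' \o x)) (G (e' \o x)) g _ gl _ b i bl it.
- by apply: Gg; exists (e' \o x).
- by case: (GP (e' \o x)).
pose j' : below t := SigSub (mem_set (jt : below t j)).
have [xD nxD] := xP j'; apply: nxD; apply: XD; split=> //.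
by exists j' => //=; rewrite e'e.
Qed.

(** An injection [f] of [X] into [c] cuts [X] into increasing pieces [Y a], to which the induction
    hypothesis applies; it remains to merge their indices [J a] into one [j]. *)
Lemma lt_plus_card_captured c X : l < plus_card t t -> c < l ->
  X `<=` below l -> X #<= below c -> exists2 g, g < l & captured t l D X g.
Proof.
move=> lt; elim/On_ind: c X => c IH X cl Xl Xc.
have [ct|tc] := leP c t.
  apply: ldc_captured => //; apply: card_le_trans Xc _.
  exact/subset_card_le/le_below.
have [k [kC kc kcard]] := card_of_below c.
move: kc; rewrite le_eqVlt => /orP[/eqP kc|kc]; last first.
  apply: (IH _ kc) => //; first exact: lt_trans kc cl.
  by rewrite (card_le_eqr kcard).
rewrite {}kc in kC; move: kcard => _.
have tinf : infinite_set (below t) by case: tR.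
have inf a : t <= a -> infinite_set (below a).
  by move=> /le_below ta /(sub_finite_set ta).
have [f fc fI] := card_le_inj Xc.
pose Y a := X `&` [set x | f x < a].
have YG a : exists g, a < c -> g < l /\ captured t l D (Y a) g.
  have [ac|_] := ltP a c; last by exists On0.
  have [|||g] := IH a ac (Y a); last by exists g.
  - exact: lt_trans cl.
  - by move=> x [/Xl].
  - apply: (@inj_le_card _ _ _ _ f) => [x []//|x y].
    by rewrite !inE => -[Xx _] [Xy _]; apply: fI; rewrite inE.
have [G GP] := choice YG.
have [a ac|g gl Gg] := @regular_image_bounded l c G lR cl; first by case: (GP a ac).
exists g => // b i bl it.
have YJ a : exists j, a < c -> j < t /\ Y a `&` D i b `<=` D j g.
  have [ac|_] := ltP a c; last by exists On0.
  have [_ Ya] := GP a ac.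
  by have [j jt YD] := captured_le (Gg a ac) gl Ya bl it; exists j.
have [J JP] := choice YJ.
have [[xi xit [s [sc scof]]]|[h [th hc hcard]]] :=
    cardinal_lt_plus_card kC tc (lt_trans cl lt).
  (* Limit case: fewer than [t] pieces are cofinal, so regularity of [t] bounds their indices. *)
  have [eta etaxi|j jt Jj] := @regular_image_bounded t xi (J \o s) tR xit.
    by case: (JP _ (sc _ etaxi)).
  exists j => // x [Xx xD]; have [eta etaxi fxs] := scof _ (fc _ Xx).
  have [_ Dmon _] := cmD; apply: (Dmon g (J (s eta)) j) => //.
    exact: Jj.
  by have [_] := JP _ (sc _ etaxi); apply.
(* Successor case: one index recurring cofinally suffices, because the pieces increase. *)
suff [j jt jcof] : exists2 j, j < t &
    forall a, a < c -> exists a', [/\ a' < c, a <= a' & J a' = j].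
  exists j => // x [Xx xD].
  (* [Y a] asks for [f x < a] strictly, hence the step above [f x]. *)
  have [a ac fxa] := infinite_cardinal_succ kC (inf _ (ltW tc)) (fc _ Xx).
  have [a' [a'c aa' <-]] := jcof a ac.
  have [_] := JP _ a'c; apply; split=> //; split=> //.
  exact: lt_le_trans aa'.
(* Pigeonhole: otherwise each fibre of [J] is bounded by some [S j < c] and injects into [h];
   pairing with the index injects [c] into [h * h], of size at most [h < c]. *)
apply: contrapT => nj.
have Sex j : exists s, j < t -> s < c /\ forall a, a < c -> J a = j -> a < s.
  have [jt|_] := ltP j t; last by exists On0.
  apply: contrapT => ns; apply: nj; exists j => // a ac.
  apply: contrapT => na; apply: ns; exists a => _; split=> // a' a'c Ja'.
  by rewrite ltNge; apply/negP => aa'; apply: na; exists a'.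
have [S SP] := choice Sex.
have eex j : exists e : On -> On, j < t ->
    set_fun (below (S j)) (below h) e /\ set_inj (below (S j)) e.
  have [jt|_] := ltP j t; last by exists id.
  have [Sc _] := SP j jt; have [e e1 e2] := card_le_inj (hcard _ Sc).
  by exists e.
have [e eP] := choice eex.
apply: (cardinal_ncard_le kC hc).
apply: card_le_trans (infinite_card_setX (inf _ th)).
have Jt a : a < c -> J a < t by move=> ac; case: (JP a ac).
have aS a : a < c -> a < S (J a) by move=> ac; have [_] := SP _ (Jt a ac); apply.
apply: (@inj_le_card _ _ _ _ (fun a => (J a, e (J a) a))) => [a ac|a a'].
  split=> /=; first exact: lt_le_trans (Jt a ac) th.
  by have [+ _] := eP _ (Jt a ac); apply; apply: aS.
rewrite !inE => ac a'c [JJ]; rewrite JJ.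
have [_] := eP _ (Jt a' a'c); apply; rewrite inE; last exact: aS.
by rewrite -JJ; exact: aS.
Qed.

(** * Closure points and good points *)

Lemma closure_club (F : On -> On) : t < l -> (forall c, c < l -> F c < l) ->
  club l [set b | b < l /\ forall c, c < b -> F c < b].
Proof.
move=> tl Fl; have [lC linf _] := lR.
split; last first.
  move=> d dl [_ dlim]; split=> // c cd; have [a [_ Fa] /andP[ca ad]] := dlim c cd.
  exact: lt_trans (Fa c ca) ad.
split=> [b []//|g gl].
(* Iterating this step from [g] and taking the supremum of the iterates gives a closure point of
   [F]. *)
have step b : exists b', b < l -> [/\ b' < l, b < b' & forall c, c < b -> F c < b'].
  have [bl|_] := ltP b l; last by exists On0.
  have [|b1 b1l Fb1] := @regular_image_bounded l b F lR bl.
    by move=> c cb; apply: Fl; apply: lt_trans bl.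
  have [b2 b2l bb2] := infinite_cardinal_succ lC linf bl.
  exists (Order.max b1 b2) => _; split; [by rewrite gt_max b1l|by rewrite lt_max bb2 orbT|].
  by move=> c /Fb1 Fc; rewrite lt_max Fc.
have [N NP] := choice step.
pose b n := iter n N g.
have bl n : b n < l by elim: n => //= n /NP[].
(* Countably many iterates are bounded in the regular [l], which exceeds the infinite [t]. *)
have [|_ [n _ <-]|B Bl bB] := @regular_bounded l (range b) lR.
- move=> lb; apply: (cardinal_ncard_le lC tl).
  apply: card_le_trans lb _; apply: card_le_trans (card_image_le _ _) _.
  by apply/infiniteP; case: tR.
- exact: bl.
pose U := [set x | forall n, b n < x].
have UB : U B by move=> n; apply: bB; exists n.
have U0 := least_in UB.
exists (least U); last exact/ltW/(U0 0%N).
split=> [|c cU]; first exact: le_lt_trans (least_le UB) Bl.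
have [n cn] : exists n, c <= b n.
  apply: contrapT => nc; apply: (lt_least cU) => n.
  by rewrite ltNge; apply/negP => cn; apply: nc; exists n.
(* [c <= b n < b n.+1], and the values of [F] below [b n.+1] stay below [b n.+2]. *)
have [_ bSn _] := NP _ (bl n); have [_ _ HF] := NP _ (bl n.+1).
exact: lt_trans (HF c (le_lt_trans cn bSn)) (U0 n.+2).
Qed.

Lemma captured_good_points :
  (forall c, c < l -> exists2 g, g < l & captured t l D (below c) g) ->
  ~ stationary l (S_gt l t `\` good_points t l D).
Proof.
(* If [l <= t], no [b < l] has cofinality above [t], and the club of all ordinals below [l] already
   refutes stationarity. *)
move=> capt stat; have [lt|tl] := leP l t.
  have [|b [[[bl tb] _] _]] := stat (below l).
    split; last by move=> d.
    by split=> // g gl; exists g.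
  have := lt_le_trans tb (cf_le b); rewrite ltNge => /negP; apply.
  exact/ltW/(lt_le_trans bl).
have Fex c : exists g, c < l -> g < l /\ captured t l D (below c) g.
  have [cl|_] := ltP c l; last by exists On0.
  by have [g gl cg] := capt c cl; exists g.
have [F FP] := choice Fex.
have [|b [[[bl tb] nb] [_ Fb]]] := stat _ (closure_club (F := F) tl _).
  by move=> c /FP[].
apply: nb; split=> //.
have [bU _ _] := cmD.
have Db i : i < t -> D i b `<=` below b.
  by move=> it x xD; rewrite bU //; exists i.
(* [D i b] witnesses goodness: its trace on [c < b] lies in some [D j (F c)], and [F c < b] by
   closure. *)
suff [i it Dub] : exists2 i, i < t & unbounded_in b (D i b).
  exists (D i b) => // c cb; have [Fcl Fc] := FP c (lt_trans cb bl).
  have [j jt Dj] := Fc b i bl it; exists (F c), j; split=> //; first exact: Fb.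
  by rewrite setIC.
(* Otherwise each [D i b] has a bound [s i < b]; as [cf b > t], some [g < b] exceeds all [s i], yet
   [g] lies in some [D i b]. *)
apply: contrapT => nub.
have sex i : exists s, i < t -> s < b /\ D i b `<=` below s.
  have [it|_] := ltP i t; last by exists On0.
  have [||] := @bounded_or_unbounded b (D i b); first exact: Db.
    by move=> [s sb Ds]; exists s.
  by move=> Dub; case: nub; exists i.
have [s sP] := choice sex.
have [|_ [i it <-]|g gb sg] := @cf_gt_bounded b t (s @` below t) tb.
- exact: card_image_le.
- by case: (sP i it).
have : below b g by [].
rewrite bU // => -[i it giD]; have [_ /(_ _ giD) gs] := sP i it.
have : s i < g by apply: sg; exists i.
by move=> /(lt_trans gs); rewrite ltxx.
Qed.

End Captured.

Theorem theorem6p18 (theta lambda : On) (D : On -> On -> set On) :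
  regular_cardinal theta ->
  regular_cardinal lambda ->
  (succ_card theta < lambda /\ lambda < plus_card theta theta) \/
    inaccessible_for theta lambda ->
  covering_matrix theta lambda D ->
  locally_downward_coherent theta lambda D ->
  ~ stationary lambda (S_gt lambda theta `\` good_points theta lambda D).
Proof.
move=> tR lR hyp cmD ldcD; apply: captured_good_points => // c cl.
case: hyp => [[_ lt]|inacc]; last exact: inaccessible_captured.
by apply: (lt_plus_card_captured tR lR cmD ldcD lt cl) => //; exact/le_below/ltW.
Qed.
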